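(* Let the closed-loop system with transfer function $T(s)=\frac{b(s)d(s)}{a(s)c(s)+b(s)d(s)}$ be given, let $y:[0,\infty)\to\mathbb{R}$ be its response (from zero initial conditions) to a reference input $r$, i.e. $y$ is the inverse Laplace transform of $y(s)=T(s)r(s)$, and assume that $y(s)$ has only distinct poles, so that $$y(s)=\sum_{i=0}^{n_r}\frac{y_i}{s+p_i}+\sum_{i=n_r+1}^{n_r+n_c/2}\left(\frac{y_i}{s+\alpha_i+j\beta_i}+\frac{y_i^*}{s+\alpha_i-j\beta_i}\right),$$ where $y_i\in\mathbb{R}$, $p_i\ge 0$ for $0\le i\le n_r$, and $y_i=a_i+jb_i\in\mathbb{C}$ ($a_i,b_i\in\mathbb{R}$), $\alpha_i\ge 0$, $\beta_i>0$ for $n_r+1\le i\le n_r+n_c/2$. Assume that all $p_i,\alpha_i,\beta_i$ are rational numbers. Let $m>0$ be the smallest positive real number such that $\bar p_i:=m p_i$ and $\bar\alpha_i:=m\alpha_i$ are integers for all $i$, and let $\theta>0$ be a real number such that $\bar\beta_i:=m\beta_i/\theta$ is an integer for all $i$. Then $$\{\,y(t)\mid t\in[0,\infty)\,\}=\{\,y(u,v,\lambda)\mid (u,v,\lambda)\in\mathcal{F}_{\text{original}}\,\},$$ where $y(u,v,\lambda)$ is the multivariate polynomial $$y(u,v,\lambda)=\sum_{i=0}^{n_r}y_i\lambda^{\bar p_i}+\sum_{i=n_r+1}^{n_r+n_c/2}\bigl(2a_i\,w_i(u,v)+2b_i\,r_i(u,v)\bigr)\lambda^{\bar\alpha_i},$$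 with the real polynomials $w_i,r_i:\mathbb{R}^2\to\mathbb{R}$ given by $w_i(u,v)=\operatorname{Re}\,(u+jv)^{\bar\beta_i}$ and $r_i(u,v)=\operatorname{Im}\,(u+jv)^{\bar\beta_i}$, and $$\mathcal{F}_{\text{original}}:=\{(u,v,\lambda)\in\mathbb{R}^3\mid u=\cos(\theta\tau),\ v=\sin(\theta\tau),\ \lambda=e^{-\tau}\text{ for some }\tau\in[0,\infty)\}.$$
   Context: $j$ is the imaginary unit and $*$ denotes complex conjugation. The plant is a single-input-single-output linear system with strictly proper real rational transfer function $P(s)=b(s)/a(s)$ ($a,b$ real polynomials), and the controller is $C(s)=d(s)/c(s)$, a proper real rational transfer function. They are connected in a unity negative feedback loop, so that the transfer function from the reference $r$ to the output $y$ is $T(s)=\frac{b(s)d(s)}{a(s)c(s)+b(s)d(s)}$. All roots of the closed-loop polynomial $a(s)c(s)+b(s)d(s)$ have strictly negative real part. The reference $r$ is real-valued and has a rational Laplace transform $r(s)$ (for instance a step $1/s$, or a sinusoid $\omega/(s^2+\omega^2)$). In the partial fraction decomposition, $-p_i$ ($0\le i\le n_r$) are the real poles and $-\alpha_i\pm j\beta_i$ are the complex conjugate pairs of poles of $y(s)$; $n_c$ is the (even) number of non-real poles. *)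

(* Defs.v *)
From HB Require Import structures.
From mathcomp Require Import all_boot all_order all_algebra.
From mathcomp Require Import all_classical all_reals all_analysis.
From mathcomp Require Export complex.
From mathcomp Require mpoly.

Set Implicit Arguments.
Unset Strict Implicit.
Unset Printing Implicit Defensive.
Import Order.TTheory GRing.Theory Num.Theory numFieldNormedType.Exports.

Local Open Scope classical_set_scope.
Local Open Scope ring_scope.
Local Open Scope complex_scope.

Section Laplace.
Context {R : realType}.
Local Notation mu := (@lebesgue_measure R).

Definition cexp (z : R[i]) : R[i] :=
  (expR (complex.Re z) * cos (complex.Im z)) +i*
  (expR (complex.Re z) * sin (complex.Im z)).

Definition cintegrable (D : set R) (g : R -> R[i]) : Prop :=
  mu.-integrable D (fun t => (complex.Re (g t))%:E) /\
  mu.-integrable D (fun t => (complex.Im (g t))%:E).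

Definition cintegral (D : set R) (g : R -> R[i]) : R[i] :=
  (\int[mu]_(t in D) complex.Re (g t)) +i* (\int[mu]_(t in D) complex.Im (g t)).

Definition laplace_kernel (f : R -> R) (s : R[i]) (t : R) : R[i] :=
  (f t)%:C * cexp (- (s * t%:C)).

(* [F] is the (one-sided) Laplace transform of [f] on some right half-plane of
   absolute convergence; only the values of [f] on [0, +oo[ matter. *)
Definition has_laplace (f : R -> R) (F : R[i] -> R[i]) : Prop :=
  exists s0 : R, forall s : R[i], s0 < complex.Re s ->
    cintegrable `[0, +oo[ (laplace_kernel f s) /\
    F s = cintegral `[0, +oo[ (laplace_kernel f s).

(* A Laplace transform determines the signal only almost everywhere: "the"
   inverse transform is its continuous representative on [0, +oo[. *)
Definition inverse_laplace (F : R[i] -> R[i]) (y : R -> R) : Prop :=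
  {within `[0, +oo[, continuous y} /\ has_laplace y F.

End Laplace.

Section ClosedLoop.
Context {R : realType}.
Implicit Types a b c d p q : {poly R}.

Definition ceval p (s : R[i]) : R[i] := (map_poly (real_complex R) p).[s].

(* The rational function p/q, as a function on C; meaningful where q does not
   vanish. *)
Definition ratfun p q (s : R[i]) : R[i] := ceval p s / ceval q s.

Definition closed_loop_poly a b c d : {poly R} := a * c + b * d.

Definition closed_loop_tf a b c d : R[i] -> R[i] :=
  ratfun (b * d) (closed_loop_poly a b c d).

Definition stable_poly p : Prop :=
  forall s : R[i], ceval p s = 0 -> complex.Re s < 0.

End ClosedLoop.

Section ParametricForm.
Context {R : realType}.
Variables (nr nh : nat).

Definition partial_fractions
    (yr p : 'I_nr.+1 -> R)
    (yc : 'I_nh -> R[i]) (alpha beta : 'I_nh -> R) (s : R[i]) : R[i] :=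
  \sum_(i < nr.+1) (yr i)%:C / (s + (p i)%:C) +
  \sum_(i < nh) (yc i / (s + (alpha i)%:C + 'i * (beta i)%:C) +
                 (yc i)^* / (s + (alpha i)%:C - 'i * (beta i)%:C)).

Definition integral_scalings (p : 'I_nr.+1 -> R) (alpha : 'I_nh -> R) : set R :=
  [set m | [/\ 0 < m,
               forall i, m * p i \is a Num.int &
               forall i, m * alpha i \is a Num.int]].

Definition w_pol (k : nat) (u v : R) : R := complex.Re ((u +i* v) ^+ k).
Definition r_pol (k : nat) (u v : R) : R := complex.Im ((u +i* v) ^+ k).

Definition y_pol
    (yr : 'I_nr.+1 -> R) (yc : 'I_nh -> R[i])
    (pbar : 'I_nr.+1 -> nat) (alphabar betabar : 'I_nh -> nat)
    (u v l : R) : R :=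
  \sum_(i < nr.+1) yr i * l ^+ pbar i +
  \sum_(i < nh) (2 * complex.Re (yc i) * w_pol (betabar i) u v +
                 2 * complex.Im (yc i) * r_pol (betabar i) u v) * l ^+ alphabar i.

End ParametricForm.

Definition F_original {R : realType} (theta : R) : set (R * R * R) :=
  [set x | exists tau : R, 0 <= tau /\
     x = (cos (theta * tau), sin (theta * tau), expR (- tau))].

(* [y_pol] really is a polynomial in three variables. *)
Module Polynomiality.
Import -(notations) mpoly.
Section Polynomiality.
Context {R : realType}.
Local Notation ev u v l := (mpoly.meval (fun i : 'I_3 => nth 0 [:: u; v; l] i)).

Lemma w_r_pol_mpoly (k : nat) : exists W Z : mpoly.mpoly 3 R, forall u v l : R,
  ev u v l W = w_pol k u v /\ ev u v l Z = r_pol k u v.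
Proof.
elim: k => [|k [W [Z WZ]]].
  by exists 1, 0 => u v l; rewrite mpoly.meval1 mpoly.meval0.
pose X i : mpoly.mpoly 3 R := mpoly.mpolyX R (mpoly.mnm1 i).
exists (X (inord 0) * W - X (inord 1) * Z),
       (X (inord 0) * Z + X (inord 1) * W) => u v l.
have [Hw Hr] := WZ u v l.
rewrite mpoly.mevalB mpoly.mevalD !mpoly.mevalM !mpoly.mevalXU !inordK //= Hw Hr.
rewrite /w_pol /r_pol exprS.
by case: ((u +i* v) ^+ k).
Qed.

Lemma y_pol_mpoly (nr nh : nat) (yr : 'I_nr.+1 -> R) (yc : 'I_nh -> R[i])
    (pbar : 'I_nr.+1 -> nat) (alphabar betabar : 'I_nh -> nat) :
  exists Q : mpoly.mpoly 3 R, forall u v l : R,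
    ev u v l Q = y_pol yr yc pbar alphabar betabar u v l.
Proof.
pose X : mpoly.mpoly 3 R := mpoly.mpolyX R (mpoly.mnm1 (inord 2)).
have /choice [W HW] := w_r_pol_mpoly.
have /choice [Z HZ] := HW.
exists (\sum_(i < nr.+1) mpoly.mpolyC 3 (yr i) * X ^+ pbar i +
  \sum_(i < nh) (mpoly.mpolyC 3 (2 * complex.Re (yc i)) * W (betabar i) +
                 mpoly.mpolyC 3 (2 * complex.Im (yc i)) * Z (betabar i)) *
                X ^+ alphabar i).
move=> u v l; rewrite mpoly.mevalD !raddf_sum /=; congr (_ + _).
  by apply: eq_bigr => i _;
    rewrite mpoly.mevalM rmorphXn /= mpoly.mevalC mpoly.mevalXU inordK.
apply: eq_bigr => i _; have [Hw Hr] := HZ (betabar i) u v l.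
by rewrite mpoly.mevalM mpoly.mevalD !mpoly.mevalM rmorphXn /= !mpoly.mevalC
  mpoly.mevalXU inordK //= Hw Hr.
Qed.

End Polynomiality.
End Polynomiality.

(* Main.v *)
(* The partial fractions are, term by term, the Laplace transform of a sum of
   damped exponentials and sinusoids, and a continuous function is determined
   by its Laplace transform on a half-line of real arguments (Lerch), so y is
   that sum. Putting t = m tau turns each exponential into a power of
   exp (- tau) and, by de Moivre, each sinusoid into the real or imaginary part
   of a power of (cos (theta tau) + j sin (theta tau)).

   For Lerch's theorem: if all moments of h against the powers of exp (- t)
   vanish but h(t0) > 0, integrate h against powers of a polynomial in exp (- t)
   that is at least 1 near t0 and at most some rho < 1 outside a neighbourhood
   where h > 0. The first part of the integral stays bounded away from 0 while
   the second one tends to 0. *)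
Require Import Defs.
From mathcomp Require Import all_boot all_order all_algebra.
From mathcomp Require Import all_classical all_reals all_analysis.
From mathcomp Require Import measurable_realfun complex polyrcf ring lra.
Import Order.TTheory GRing.Theory Num.Theory numFieldNormedType.Exports.
Local Open Scope classical_set_scope.
Local Open Scope ring_scope.
Local Open Scope complex_scope.

(** * Laplace integrals at real arguments: linearity, damped exponentials and sinusoids *)

Section RealLaplace.
Context {R : realType}.
Local Notation mu := (@lebesgue_measure R).
Implicit Types f g h : R -> R.

(** Integrability travels with the value because additivity of the integral depends on it. Real
    arguments suffice for the uniqueness theorem below. *)
Definition real_laplace_at f (x F : R) : Prop :=
  mu.-integrable `[0, +oo[ (EFin \o (fun t => f t * expR (- (x * t)))) /\
  \int[mu]_(t in `[0, +oo[) (f t * expR (- (x * t))) = F.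

Lemma real_laplace_atD f g x F G :
  real_laplace_at f x F -> real_laplace_at g x G ->
  real_laplace_at (fun t => f t + g t) x (F + G).
Proof.
move=> [fi <-] [gi <-]; split.
  apply: eq_integrable (integrableD _ fi gi) => //= t _.
  by rewrite -EFinD mulrDl.
rewrite -RintegralD//; apply: eq_Rintegral => t _; exact: mulrDl.
Qed.

Lemma real_laplace_atZ k f x F :
  real_laplace_at f x F -> real_laplace_at (fun t => k * f t) x (k * F).
Proof.
move=> [fi <-]; split.
  apply: eq_integrable (integrableZl _ k fi) => //= t _.
  by rewrite -EFinM mulrA.
by rewrite -RintegralZl//; apply: eq_Rintegral => t _; rewrite mulrA.
Qed.

Lemma real_laplace_at0 x : real_laplace_at (fun=> 0) x 0.
Proof.
split.
  by apply: eq_integrable (integrable0 mu _) => //= t _; rewrite mul0r.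
rewrite (@eq_Rintegral _ _ _ _ _ (cst 0)).
  by rewrite Rintegral_cst// mul0r.
by move=> t _; rewrite mul0r.
Qed.

Lemma real_laplace_at_sum (I : Type) (s : seq I) (f : I -> R -> R) x (F : I -> R) :
  (forall i, real_laplace_at (f i) x (F i)) ->
  real_laplace_at (fun t => \sum_(i <- s) f i t) x (\sum_(i <- s) F i).
Proof.
move=> fF; elim: s => [|i s IHs].
  under eq_fun do rewrite big_nil.
  by rewrite big_nil; exact: real_laplace_at0.
under eq_fun do rewrite big_cons.
by rewrite big_cons; exact: real_laplace_atD.
Qed.

(* A primitive of [exp (- c t) (M + A cos (beta t) + B sin (beta t))]. The
   fundamental theorem of calculus on [0, +oo[ wants a nonnegative integrand,
   whence the constant M, to be chosen at least |A| + |B|. *)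
Let trig_prim (c A B beta M : R) (t : R) : R :=
  expR (- (c * t)) * (- (M / c) +
    (A * (beta * sin (beta * t) - c * cos (beta * t)) -
     B * (c * sin (beta * t) + beta * cos (beta * t))) / (c ^+ 2 + beta ^+ 2)).

Lemma is_derive_trig_prim (c A B beta M x : R) : 0 < c ->
  is_derive x (1 : R) (trig_prim c A B beta M)
    (expR (- (c * x)) * (M + (A * cos (beta * x) + B * sin (beta * x)))).
Proof.
move=> c0; have d0 : 0 < c ^+ 2 + beta ^+ 2.
  by rewrite ltr_wpDr ?sqr_ge0// exprn_gt0.
apply: is_derive_eq; rewrite /GRing.scale/=.
by field; rewrite !gt_eqF.
Qed.

Lemma cvg_trig_prim (c A B beta M : R) : 0 < c ->
  trig_prim c A B beta M x @[x --> +oo] --> 0.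
Proof.
move=> c0.
set d := c ^+ 2 + beta ^+ 2.
(* Bound for the factor multiplying the exponential in [trig_prim], obtained from |sin| <= 1 and
   |cos| <= 1. *)
pose K := `|M / c| + (`|A| * (`|beta| + `|c|) + `|B| * (`|c| + `|beta|)) / `|d|.
have expc : expR (- (c * x)) @[x --> +oo] --> (0 : R).
  apply: (@cvg_comp _ _ _ (fun x => c * x) (fun x => expR (- x)) _
    (pinfty_nbhs R)); last exact: cvgr_expR.
  by apply: gt0_cvgMry => //; exact: cvg_id.
have trig_le t : `|sin (beta * t)| <= 1 /\ `|cos (beta * t)| <= 1.
  by split; rewrite ler_norml ?sin_geN1 ?sin_le1 ?cos_geN1 ?cos_le1.
have bound t : `|trig_prim c A B beta M t| <= K * expR (- (c * t)).
  rewrite /trig_prim normrM (ger0_norm (expR_ge0 _)) mulrC.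
  rewrite ler_wpM2r ?expR_ge0//.
  have [s1 c1] := trig_le t.
  rewrite (le_trans (ler_normD _ _))// normrN lerD// normrM normfV.
  rewrite ler_wpM2r ?invr_ge0// (le_trans (ler_normB _ _))// !normrM.
  have le1 (u v : R) : `|v| <= 1 -> `|u| * `|v| <= `|u|.
    by move=> v1; rewrite ler_piMr.
  rewrite lerD// ler_wpM2l// ?(le_trans (ler_normB _ _)) ?(le_trans (ler_normD _ _))//.
    by rewrite !normrM lerD// le1.
  by rewrite !normrM lerD// le1.
apply: (@squeeze_cvgr _ _ _ _ (fun t => - (K * expR (- (c * t))))
  (fun t => K * expR (- (c * t)))).
- by near=> t; rewrite -ler_norml.
- by rewrite -oppr0 -(mulr0 K); apply: cvgN; exact: cvgMr.
- by rewrite -(mulr0 K); exact: cvgMr.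
Unshelve. all: by end_near. Qed.

(** As |A cos + B sin| <= |A| + |B| <= M, the integrand is nonnegative. The fundamental theorem on
    the half-line then gives minus the primitive at 0, and finiteness of this same integral yields
    integrability. *)
Lemma real_laplace_at_trig_shift (al A B beta M x : R) :
  `|A| + `|B| <= M -> 0 < x + al ->
  real_laplace_at
    (fun t => expR (- (al * t)) * (M + (A * cos (beta * t) + B * sin (beta * t)))) x
    (M / (x + al) +
     (A * (x + al) + B * beta) / ((x + al) ^+ 2 + beta ^+ 2)).
Proof.
move=> ABM; set c := x + al => c0.
pose k t := expR (- (c * t)) * (M + (A * cos (beta * t) + B * sin (beta * t))).
have kE t : expR (- (al * t)) * (M + (A * cos (beta * t) + B * sin (beta * t))) *
    expR (- (x * t)) = k t.
  by rewrite mulrAC -expRD /k/c; congr (expR _ * _); ring.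
have k_ge0 t : 0 <= k t.
  rewrite mulr_ge0 ?expR_ge0//.
  have le1 (u v : R) : `|v| <= 1 -> - `|u| <= u * v.
    move=> v1; suff : `|u * v| <= `|u| by rewrite ler_norml => /andP[].
    by rewrite normrM ler_piMr.
  have := le1 A (cos (beta * t)); have := le1 B (sin (beta * t)).
  rewrite !ler_norml sin_geN1 sin_le1 cos_geN1 cos_le1 => /(_ isT) ? /(_ isT) ?.
  lra.
have k_cont : continuous k.
  move=> t; apply: differentiable_continuous; apply/derivable1_diffP.
  by apply: ex_derive.
have intk : (\int[mu]_(t in `[0%R, +oo[) (k t)%:E =
    (0 : R)%:E - (trig_prim c A B beta M 0)%:E)%E.
  apply: ge0_continuous_FTC2y.
  - by move=> t _; exact: k_ge0.
  - exact: continuous_subspaceT.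
  - exact: cvg_trig_prim.
  - by move=> t _; have := is_derive_trig_prim c A B beta M t c0 => -[].
  - apply: cvg_at_right_filter; apply: differentiable_continuous.
    by apply/derivable1_diffP; have := is_derive_trig_prim c A B beta M 0 c0 => -[].
  - move=> t _; rewrite derive1E.
    by have := is_derive_trig_prim c A B beta M t c0 => h; rewrite derive_val.
have k_integrable : mu.-integrable `[0, +oo[ (EFin \o k).
  apply/integrableP; split.
    apply/measurable_EFinP; apply: measurable_funTS.
    exact: continuous_measurable_fun.
  under eq_integral do rewrite /= ger0_norm//.
  by rewrite intk -EFinB ltry.
split; first by apply: eq_integrable k_integrable => //= t _; rewrite kE.
under eq_Rintegral do rewrite kE.
rewrite /Rintegral intk -EFinB /= /trig_prim !mulr0 oppr0 expR0 sin0 cos0.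
field; rewrite !gt_eqF//.
by rewrite ltr_wpDr ?sqr_ge0// exprn_gt0.
Qed.

Lemma real_laplace_at_exp (al x : R) : 0 < x + al ->
  real_laplace_at (fun t => expR (- (al * t))) x (x + al)^-1.
Proof.
move=> xal; have := real_laplace_at_trig_shift al 0 0 0 1 x.
rewrite normr0 addr0 => /(_ ler01 xal).
rewrite !mul0r addr0 mul0r addr0 mul1r; congr (real_laplace_at _ _ _).
by apply/funext => t; rewrite !mul0r !addr0 mulr1.
Qed.

(** Take M = |A| + |B| in the shifted version and subtract the transform of M exp (- al t) by
    linearity. *)
Lemma real_laplace_at_trig (al A B beta x : R) : 0 < x + al ->
  real_laplace_at
    (fun t => expR (- (al * t)) * (A * cos (beta * t) + B * sin (beta * t))) x
    ((A * (x + al) + B * beta) / ((x + al) ^+ 2 + beta ^+ 2)).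
Proof.
move=> xal.
have := real_laplace_atD _ _ _ _ _
  (real_laplace_at_trig_shift al A B beta _ x (lexx _) xal)
  (real_laplace_atZ (- (`|A| + `|B|)) _ _ _ (real_laplace_at_exp al x xal)).
rewrite mulNr addrAC subrr add0r; congr (real_laplace_at _ _ _).
by apply/funext => t; ring.
Qed.

(** * Lerch's uniqueness theorem through moments in exp (- t) *)

(** Horner induction on q: for t >= 0 the factor exp (- t) is at most 1, so it preserves
    integrability. *)
Lemma integrable_mul_polyexp h (q : {poly R}) :
  mu.-integrable `[0, +oo[ (EFin \o h) ->
  mu.-integrable `[0, +oo[ (EFin \o (fun t => h t * q.[expR (- t)])).
Proof.
move=> hi; elim/poly_ind: q => [|q a IHq].
  by apply: eq_integrable (integrable0 mu _) => //= t _; rewrite horner0 mulr0.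
have qi : mu.-integrable `[0, +oo[
    (EFin \o (fun t => h t * q.[expR (- t)] * expR (- t))).
  apply: (le_integrable _ _ _ IHq) => //.
    apply/measurable_EFinP; apply: measurable_funM.
      by apply/measurable_EFinP; exact: measurable_int IHq.
    apply: measurable_funTS; apply: continuous_measurable_fun => t.
    apply: differentiable_continuous; apply/derivable1_diffP.
    by apply: ex_derive.
  move=> t; rewrite /= in_itv/= andbT => t0.
  by rewrite lee_fin normrM ler_piMr// ger0_norm ?expR_ge0// -expR0 ler_expR oppr_le0.
apply: eq_integrable (integrableD _ qi (integrableZl _ a hi)) => //= t _.
by rewrite -EFinD hornerMXaddC; congr EFin; ring.
Qed.

Lemma Rintegral_mul_polyexp_eq0 h (q : {poly R}) :
  mu.-integrable `[0, +oo[ (EFin \o h) ->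
  (forall k, \int[mu]_(t in `[0, +oo[) (h t * expR (- t) ^+ k) = 0) ->
  \int[mu]_(t in `[0, +oo[) (h t * q.[expR (- t)]) = 0.
Proof.
move=> hi h0.
(* The extra factor 'X^k makes the induction go through: passing from q to q * 'X + a raises k by
   one and leaves a multiple of the k-th moment. *)
suff H k : \int[mu]_(t in `[0, +oo[) (h t * (q * 'X^k).[expR (- t)]) = 0.
  by have := H 0%N; rewrite expr0 mulr1.
elim/poly_ind: q k => [|q a IHq] k.
  rewrite (@eq_Rintegral _ _ _ _ _ (cst 0)) ?Rintegral_cst ?mul0r// => t _.
  by rewrite horner0 mulr0.
have ik (p : {poly R}) := integrable_mul_polyexp h p hi.
transitivity (\int[mu]_(t in `[0, +oo[) (h t * (q * 'X^(k.+1)).[expR (- t)] +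
    a * (h t * ('X^k).[expR (- t)]))).
  by apply: eq_Rintegral => t _;
    rewrite !(hornerM, hornerXn, hornerMXaddC) exprS; ring.
rewrite RintegralD//; last first.
  by apply: eq_integrable (integrableZl _ a (ik 'X^k)).
rewrite RintegralZl// IHq add0r.
transitivity (a * \int[mu]_(t in `[0, +oo[) (h t * expR (- t) ^+ k)).
  by congr (_ * _); apply: eq_Rintegral => t _; rewrite hornerXn.
by rewrite h0 mulr0.
Qed.

Lemma moments_eq0_le0 h :
  mu.-integrable `[0, +oo[ (EFin \o h) ->
  {within `[0, +oo[, continuous h} ->
  (forall k, \int[mu]_(t in `[0, +oo[) (h t * expR (- t) ^+ k) = 0) ->
  forall t : R, 0 <= t -> h t <= 0.
Proof.
move=> hi hc h0 t0 t0_ge0; rewrite leNgt; apply/negP => ht0.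
pose e := h t0 / 2; have e0 : 0 < e by rewrite divr_gt0.
pose x0 := expR (- t0); have x00 : 0 < x0 := expR_gt0 _.
have x01 : x0 <= 1 by rewrite -expR0 ler_expR oppr_le0.
have [d d0 hd] : exists2 d : R, 0 < d & forall t : R, 0 <= t -> `|t0 - t| < d -> e <= h t.
  have t0D : `[0, +oo[%classic t0 by rewrite /= in_itv/= t0_ge0.
  have /subspace_continuousP/(_ _ t0D) := hc.
  move=> /cvgr_ge => /(_ e); rewrite ltr_pdivrMr// mulr_natr.
  rewrite mulr2n ltrDl => /(_ ht0) /nbhs_ballP[d /= d0 hd].
  exists d => // t t_ge0 td; apply: hd; first exact: td.
  by rewrite /= in_itv/= t_ge0.
(* Continuity of ln turns closeness of exp (- t) to x0 into closeness of t to t0. Capping r at 1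
   keeps [rho] nonnegative. *)
have [r [r0 r1] hr] : exists2 r : R, 0 < r /\ r <= 1 &
    forall t : R, `|x0 - expR (- t)| < r -> `|t0 - t| < d.
  have := continuous_ln x00 => /cvgr_dist_lt => /(_ _ d0) /nbhs_ballP[r /= r0 hr].
  exists (Num.min r 1); first by rewrite lt_min r0 ltr01 ge_min lexx orbT.
  move=> t; rewrite lt_min => /andP[tr _]; have /= := hr _ tr.
  rewrite /x0 !expRK.
  by rewrite [t0 - t](_ : _ = - (- t0 - - t)) ?normrN//; ring.
have [g g0 hg] : exists2 g : R, 0 < g &
    forall t : R, `|t0 - t| < g -> `|x0 - expR (- t)| < r / 2.
  have r20 : 0 < r / 2 by rewrite divr_gt0.
  have := @continuous_expR R (- t0) => /cvgr_dist_lt/(_ _ r20)/nbhs_ballP[g /= g0 hg].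
  exists g => // t tg; apply: hg; rewrite /ball/=.
  by rewrite [X in `|X|](_ : _ = - (t0 - t)) ?normrN//; ring.
(* Peak polynomial in x = exp (- t): nonnegative on [0, 1], at least 1 where |x - x0| <= r / 2, at
   most [rho] where |x - x0| >= r. *)
pose q : {poly R} := (1 + r ^+ 2 / 2)%:P - ('X - x0%:P) ^+ 2.
(* J extends only to the right of t0, so it stays in [0, +oo[ even when t0 = 0; the half width keeps
   it within distance g of t0. *)
pose J : set R := `[t0, t0 + g / 2]%classic.
pose rho := 1 - r ^+ 2 / 2.
have qE t : q.[expR (- t)] = 1 + r ^+ 2 / 2 - (x0 - expR (- t)) ^+ 2.
  by rewrite /q !hornerE; ring.
have r2 : r ^+ 2 <= 1 by rewrite expr_le1// ltW.
have r20 : 0 < r ^+ 2 by rewrite exprn_gt0.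
have rho0 : 0 <= rho by rewrite /rho; lra.
have q_ge0 t : 0 <= t -> 0 <= q.[expR (- t)].
  move=> t_ge0; rewrite qE.
  have et0 : 0 < expR (- t) := expR_gt0 _.
  have et1 : expR (- t) <= 1 by rewrite -expR0 ler_expR oppr_le0.
  suff : (x0 - expR (- t)) ^+ 2 <= 1 by lra.
  by rewrite -real_normK ?num_real// expr_le1// ler_norml; lra.
(* Three zones: on J both h >= e and q >= 1; where |x0 - exp (- t)| >= r, q <= [rho] bounds the
   loss; elsewhere h and q are nonnegative. *)
have lower n t : 0 <= t ->
    e * \1_J t - rho ^+ n * `|h t| <= h t * q.[expR (- t)] ^+ n.
  move=> t_ge0; have qt0 := q_ge0 _ t_ge0.
  have rn : 0 <= rho ^+ n * `|h t| by rewrite mulr_ge0// exprn_ge0.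
  have [rt|rt] := ltP `|x0 - expR (- t)| r; last first.
    have -> : \1_J t = 0 :> R.
      rewrite indicE memNset// /J/= in_itv/= => /andP[tt0 ttg].
      have : `|t0 - t| < g by rewrite ltr_norml; lra.
      by move=> /hg; lra.
    rewrite mulr0 sub0r lerNl (le_trans (ler_norm _))// normrN normrM mulrC.
    rewrite ler_wpM2r// normrX ger0_norm// lerXn2r ?nnegrE//.
    rewrite qE /rho; suff : r ^+ 2 <= (x0 - expR (- t)) ^+ 2 by lra.
    by rewrite -[leRHS]real_normK ?num_real// lerXn2r ?nnegrE// ltW.
  have het : e <= h t by apply: hd => //; exact: hr.
  have het0 : 0 <= h t by rewrite (le_trans _ het)// ltW.
  have [tJ|tJ] := pselect (J t); last first.
    rewrite indicE memNset// mulr0 sub0r.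
    by rewrite (@le_trans _ _ 0)// ?oppr_le0// mulr_ge0// exprn_ge0.
  rewrite indicE mem_set// mulr1 lerBlDr (@le_trans _ _ (h t))//.
  rewrite -[leLHS]addr0 lerD// ler_peMr// exprn_ege1// qE.
  move: tJ; rewrite /J/= in_itv/= => /andP[tt0 ttg].
  have /hg hgt : `|t0 - t| < g by rewrite ltr_norml; lra.
  suff : (x0 - expR (- t)) ^+ 2 <= (r / 2) ^+ 2 by rewrite expr_div_n; lra.
  by rewrite -[leLHS]real_normK ?num_real// lerXn2r ?nnegrE// ?ltW// divr_gt0.
have indJ : mu.-integrable `[0, +oo[ (EFin \o (\1_J : R -> R)).
  by apply: integrableS (integrable_indic_itv t0 (t0 + g / 2) true false).
have intJ : \int[mu]_(t in `[0, +oo[) (\1_J t : R) = g / 2.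
  rewrite /Rintegral integral_indic//; last exact: measurable_itv.
  rewrite setIidl; last first.
    by move=> t; rewrite /J/= !in_itv/= andbT => /andP[/(le_trans t0_ge0)].
  have := lebesgue_measure_itv `[t0, t0 + g / 2].
  rewrite /= lte_fin ltrDl divr_gt0// -EFinB addrAC subrr add0r => muJ.
  by rewrite [X in fine X]muJ.
have nh : mu.-integrable `[0, +oo[ (EFin \o (fun t => `|h t|)).
  exact: integrable_abse hi.
(* Integrate [lower]: the right side vanishes by the moment hypothesis, and J has length g / 2.
   Letting n grow contradicts e * (g / 2) > 0. *)
have key n : e * (g / 2) <= rho ^+ n * \int[mu]_(t in `[0, +oo[) `|h t|.
  have i1 : mu.-integrable `[0, +oo[ (EFin \o (fun t => e * \1_J t)).
    exact: (integrableZl _ e indJ).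
  have i2 : mu.-integrable `[0, +oo[ (EFin \o (fun t => rho ^+ n * `|h t|)).
    exact: (integrableZl _ (rho ^+ n) nh).
  rewrite -subr_ge0 -oppr_le0 opprB -intJ -!RintegralZl// -RintegralB//.
  rewrite -[leRHS](Rintegral_mul_polyexp_eq0 h (q ^+ n) hi h0).
  apply: le_Rintegral => //.
  - by have := integrableB _ i1 i2; apply.
  - exact: integrable_mul_polyexp.
  - by move=> t; rewrite /= in_itv/= andbT horner_exp; exact: lower.
have rho1 : `|rho| < 1 by rewrite ger0_norm// /rho; lra.
have eg : 0 < e * (g / 2) by rewrite mulr_gt0 ?divr_gt0.
have := cvg_geometric (\int[mu]_(t in `[0, +oo[) `|h t|) rho1.
move=> /cvgr_lt/(_ _ eg)[n _ /(_ n (leqnn n))].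
by rewrite /= mulrC ltNge key.
Qed.

Lemma moments_eq0 h :
  mu.-integrable `[0, +oo[ (EFin \o h) ->
  {within `[0, +oo[, continuous h} ->
  (forall k, \int[mu]_(t in `[0, +oo[) (h t * expR (- t) ^+ k) = 0) ->
  forall t : R, 0 <= t -> h t = 0.
Proof.
move=> hi hc h0 t t0; apply/eqP; rewrite eq_le moments_eq0_le0//=.
rewrite -oppr_le0; apply: (moments_eq0_le0 (fun t => - h t)) => //.
- by have := integrableN hi; apply: eq_integrable.
- by move=> x; apply: continuousN; exact: hc.
- move=> k; transitivity (- 1 * \int[mu]_(t in `[0, +oo[) (h t * expR (- t) ^+ k)).
    rewrite -RintegralZl//; first by apply: eq_Rintegral => u _; rewrite mulN1r mulNr.
    apply: eq_integrable (integrable_mul_polyexp h 'X^k hi) => //= u _.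
    by rewrite hornerXn.
  by rewrite h0 mulr0.
Qed.

(** Damping f - g by exp (- x1 t) gives an integrable h whose k-th moment in exp (- t) is the
    transform of f - g at x1 + k, hence zero. *)
Lemma real_laplace_inj f g x0 :
  {within `[0, +oo[, continuous f} -> {within `[0, +oo[, continuous g} ->
  (forall x, x0 < x -> exists F, real_laplace_at f x F /\ real_laplace_at g x F) ->
  forall t : R, 0 <= t -> f t = g t.
Proof.
move=> fc gc fg t t0.
pose x1 := x0 + 1; pose h t := (f t - g t) * expR (- (x1 * t)).
have x01 : x0 < x1 by rewrite ltrDl.
have lap0 x : x0 < x -> real_laplace_at (fun t => f t - g t) x 0.
  move=> /fg[F [fF gF]].
  have := real_laplace_atD _ _ _ _ _ fF (real_laplace_atZ (-1) _ _ _ gF).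
  rewrite mulN1r subrr; congr (real_laplace_at _ _ _).
  by apply/funext => u; rewrite mulN1r.
suff : h t = 0.
  by move=> /eqP; rewrite mulf_eq0 (gt_eqF (expR_gt0 _)) orbF subr_eq0 => /eqP.
apply: moments_eq0 => //; first by case: (lap0 _ x01).
  move=> u; apply: cvgM; first by apply: cvgB; [exact: fc|exact: gc].
  apply: continuous_subspaceT => {}u; apply: differentiable_continuous.
  by apply/derivable1_diffP; apply: ex_derive.
move=> k; have [|_ I0] := lap0 (x1 + k%:R).
  by rewrite (lt_le_trans x01)// lerDl.
rewrite -[RHS]I0; apply: eq_Rintegral => u _; rewrite -mulrA -expRM_natl -expRD.
by congr (_ * expR _); ring.
Qed.

(** * The time response attached to a partial fraction expansion *)

(** At a real argument the kernel is real, so taking real parts loses nothing. *)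
Lemma has_laplace_real f (F : R[i] -> R[i]) : has_laplace f F ->
  exists s0 : R, forall x : R, s0 < x ->
    real_laplace_at f x (complex.Re (F x%:C)).
Proof.
move=> [s0 fF]; exists s0 => x s0x.
have [[fi _] ->] := fF x%:C s0x.
have ReE t : complex.Re (laplace_kernel f x%:C t) = f t * expR (- (x * t)).
  by rewrite /laplace_kernel /cexp /= !mul0r !mulr0 !(subr0, addr0, oppr0) cos0 mulr1.
split; first by apply: eq_integrable fi => // t _; congr EFin; exact: ReE.
by apply: eq_Rintegral => t _; rewrite -ReE.
Qed.

(** Each conjugate pair contributes 2 Re (yc exp (- (alpha + j beta) t)); the minus sign in the
    exponent makes the sine coefficient + 2 Im yc. *)
Definition modal_response (nr nh : nat) (yr p : 'I_nr.+1 -> R)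
    (yc : 'I_nh -> R[i]) (alpha beta : 'I_nh -> R) (t : R) : R :=
  \sum_(i < nr.+1) yr i * expR (- (p i * t)) +
  \sum_(i < nh) expR (- (alpha i * t)) *
    (2 * complex.Re (yc i) * cos (beta i * t) +
     2 * complex.Im (yc i) * sin (beta i * t)).

Lemma continuous_modal_response nr nh yr p yc alpha beta :
  continuous (@modal_response nr nh yr p yc alpha beta).
Proof.
have cont_sum n (g : 'I_n -> R -> R) : (forall i, continuous (g i)) ->
    continuous (fun t => \sum_(i < n) g i t).
  by move=> gc t; apply: cvg_big => [|i _]; [exact: add_continuous|exact: gc].
move=> t; apply: cvgD; apply: cont_sum => i {}t;
  by apply: differentiable_continuous; apply/derivable1_diffP; apply: ex_derive.
Qed.

(** Conjugate terms combine over (x + alpha)^2 + beta^2, the shape produced by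
    [real_laplace_at_trig]. *)
Lemma Re_partial_fractions nr nh (yr p : 'I_nr.+1 -> R)
    (yc : 'I_nh -> R[i]) (alpha beta : 'I_nh -> R) (x : R) :
  (forall i, 0 < x + p i) -> (forall i, 0 < x + alpha i) ->
  complex.Re (partial_fractions yr p yc alpha beta x%:C) =
  \sum_(i < nr.+1) yr i * (x + p i)^-1 +
  \sum_(i < nh) ((2 * complex.Re (yc i) * (x + alpha i) +
     2 * complex.Im (yc i) * beta i) / ((x + alpha i) ^+ 2 + beta i ^+ 2)).
Proof.
move=> xp xal; rewrite /partial_fractions !raddfD /= !raddf_sum /=.
congr (_ + _); apply: eq_bigr => i _.
  by have := xp i => xpi; rewrite /=; field; rewrite gt_eqF.
rewrite -complexiE; case: (yc i) => u v.
have d0 : (x + alpha i) ^+ 2 + beta i ^+ 2 != 0.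
  by rewrite gt_eqF// ltr_wpDr ?sqr_ge0// exprn_gt0.
by rewrite /= !(mul0r, mul1r, mulr0, subr0, add0r, addr0, sub0r, sqrrN); field.
Qed.

Lemma real_laplace_at_modal_response nr nh (yr p : 'I_nr.+1 -> R)
    (yc : 'I_nh -> R[i]) (alpha beta : 'I_nh -> R) (x : R) :
  (forall i, 0 < x + p i) -> (forall i, 0 < x + alpha i) ->
  real_laplace_at (modal_response _ _ yr p yc alpha beta) x
    (complex.Re (partial_fractions yr p yc alpha beta x%:C)).
Proof.
move=> xp xal; rewrite Re_partial_fractions//.
apply: real_laplace_atD; apply: real_laplace_at_sum => i.
  by apply: real_laplace_atZ; exact: real_laplace_at_exp.
exact: real_laplace_at_trig.
Qed.

End RealLaplace.

(** * De Moivre's formula and the substitution t = m tau *)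

Lemma de_moivre (R : realType) (a : R) (k : nat) :
  (cos a +i* sin a) ^+ k = cos (k%:R * a) +i* sin (k%:R * a).
Proof.
elim: k => [|k IHk]; first by rewrite mul0r cos0 sin0.
rewrite exprS IHk -natr1 mulrDl mul1r addrC cosD sinD.
by apply/eqP; rewrite eq_complex /= eqxx addrC eqxx.
Qed.

Lemma y_pol_modal_response (R : realType) (nr nh : nat)
    (yr p : 'I_nr.+1 -> R) (yc : 'I_nh -> R[i]) (alpha beta : 'I_nh -> R)
    (m theta : R) (pbar : 'I_nr.+1 -> nat) (alphabar betabar : 'I_nh -> nat)
    (tau : R) :
  theta != 0 ->
  (forall i, (pbar i)%:R = m * p i) ->
  (forall i, (alphabar i)%:R = m * alpha i) ->
  (forall i, (betabar i)%:R = m * beta i / theta) ->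
  y_pol yr yc pbar alphabar betabar
    (cos (theta * tau)) (sin (theta * tau)) (expR (- tau)) =
  modal_response nr nh yr p yc alpha beta (m * tau).
Proof.
move=> theta0 pE aE bE; rewrite /y_pol /modal_response.
congr (_ + _); apply: eq_bigr => i _.
  by rewrite -expRM_natl pE; congr (_ * expR _); ring.
rewrite /w_pol /r_pol de_moivre bE /= -expRM_natl aE mulrC.
have -> : m * beta i / theta * (theta * tau) = beta i * (m * tau) by field.
by congr (expR _ * _); ring.
Qed.

(** * Identification of y and equality of the two images *)

Lemma ceval_real (R : realType) (q : {poly R}) (x : R) :
  ceval q x%:C = (q.[x])%:C.
Proof. exact: horner_map. Qed.

(** Roots lie within the Cauchy bound. This provides real arguments beyond every zero of the
    reference denominator. *)
Lemma horner_neq0_eventually (R : realType) (q : {poly R}) : q != 0 ->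
  exists M : R, forall x : R, M < x -> q.[x] != 0.
Proof.
move=> q0; exists (cauchy_bound q) => x; apply: contraTneq => /(cauchy_boundP q0).
by rewrite -leNgt => /ltW; exact/le_trans/ler_norm.
Qed.

Theorem theorem3p1 (R : realType)
  (* plant P = b / a, controller C = d / c, reference r with transform rn / rd *)
  (a b c d rn rd : {poly R}) (r y : R -> R)
  (* nr + 1 real poles, nc non-real poles *)
  (nr nc : nat)
  (yr p : 'I_nr.+1 -> R)
  (yc : 'I_(nc./2) -> R[i]) (alpha beta : 'I_(nc./2) -> R)
  (m theta : R)
  (pbar : 'I_nr.+1 -> nat) (alphabar betabar : 'I_(nc./2) -> nat)
  (P_strictly_proper : (size b < size a)%N)
  (c_neq0 : c != 0)
  (C_proper : (size d <= size c)%N)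
  (T_stable : stable_poly (closed_loop_poly a b c d))
  (rd_neq0 : rd != 0)
  (r_laplace : has_laplace r (ratfun rn rd))
  (y_response :
     inverse_laplace (fun s => closed_loop_tf a b c d s * ratfun rn rd s) y)
  (nc_even : ~~ odd nc)
  (real_poles_distinct : injective p)
  (complex_poles_distinct : injective (fun i => (alpha i, beta i)))
  (y_partial_fractions : forall s : R[i],
     ceval (closed_loop_poly a b c d) s != 0 -> ceval rd s != 0 ->
     closed_loop_tf a b c d s * ratfun rn rd s =
     partial_fractions yr p yc alpha beta s)
  (p_ge0 : forall i, 0 <= p i)
  (alpha_ge0 : forall i, 0 <= alpha i)
  (beta_gt0 : forall i, 0 < beta i)
  (p_rational : forall i, rational (p i))
  (alpha_rational : forall i, rational (alpha i))
  (beta_rational : forall i, rational (beta i))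
  (m_scaling : integral_scalings p alpha m)
  (m_smallest : lbound (integral_scalings p alpha) m)
  (pbarE : forall i, (pbar i)%:R = m * p i)
  (alphabarE : forall i, (alphabar i)%:R = m * alpha i)
  (theta_gt0 : 0 < theta)
  (betabarE : forall i, (betabar i)%:R = m * beta i / theta) :
  [set y t | t in [set t : R | 0 <= t]] =
  [set y_pol yr yc pbar alphabar betabar x.1.1 x.1.2 x.2 | x in F_original theta].
Proof.
set F := fun s => _ in y_response.
have [y_cont /has_laplace_real[s0 y_lap]] := y_response.
have [M rd0] := horner_neq0_eventually _ _ rd_neq0.
have m0 : 0 < m by case: m_scaling.
have yE t : 0 <= t -> y t = modal_response _ _ yr p yc alpha beta t.
  (* Beyond 0, x is no closed-loop root by stability and all x + p i, x + alpha i are positive;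
     beyond s0 the transform of y converges; beyond M, [rd] does not vanish. *)
  apply: (real_laplace_inj _ _ (Num.max 0 (Num.max s0 M))) => //.
    exact/continuous_subspaceT/continuous_modal_response.
  move=> x; rewrite !gt_max => /and3P[x0 s0x Mx].
  exists (complex.Re (F x%:C)); split; first exact: y_lap.
  rewrite /F y_partial_fractions.
  - apply: real_laplace_at_modal_response => i; first exact: ltr_wpDr.
    exact: ltr_wpDr.
  - apply/eqP => /T_stable /=; rewrite ltNge => /negP; apply; exact: ltW.
  - by rewrite ceval_real fmorph_eq0 rd0.
have polE tau := y_pol_modal_response _ _ _ yr p yc alpha beta m theta pbar alphabar
  betabar tau (lt0r_neq0 theta_gt0) pbarE alphabarE betabarE.
(* Since m > 0, t = m tau and tau = t / m exchange the two nonnegative parameters. *)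
rewrite eqEsubset; split => [_ [t t0 <-]|_ [_ [tau [tau0 ->]] <-]] /=.
  exists (cos (theta * (t / m)), sin (theta * (t / m)), expR (- (t / m))).
    by exists (t / m); split => //; rewrite divr_ge0// ltW.
  by rewrite /= polE mulrC divfK ?gt_eqF// yE.
exists (m * tau); first by rewrite /= mulr_ge0// ltW.
by rewrite yE ?polE// mulr_ge0// ltW.
Qed.
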